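(* Let $k:\mathbb{N}^+\to\mathbb{R}^+$ be a monotone increasing function. Suppose there exists a set of grid points $S\subseteq\mathbb{Z}^2$ such that $|S\cap\ell\cap[1,n]^2|\le k(n)$ for all lines $\ell$ and all $n\in\mathbb{N}^+$. If $$\liminf_{n\to\infty}\frac{|S\cap[1,n]^2|}{k(n)\cdot n}=1,$$ then $k(n)=\Omega(n^{c})$ for every constant $c<1$.
   Context: $\mathbb{N}^+$ denotes the positive integers and $\mathbb{R}^+$ the positive reals. $[1,n]^2$ denotes the set of lattice points $(x,y)\in\mathbb{Z}^2$ with $1\le x\le n$ and $1\le y\le n$. ''Line'' means any straight line in $\mathbb{R}^2$. ''Monotone increasing'' is meant in the weak sense (non-decreasing). $k(n)=\Omega(n^c)$ means that there exist $C>0$ and $n_1$ with $k(n)\ge Cn^c$ for all $n\ge n_1$. *)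

(* Defs.v *)
From mathcomp Require Import all_boot all_order all_algebra finmap.
From mathcomp Require Import all_classical all_reals all_analysis.
Import Order.TTheory GRing.Theory Num.Theory numFieldNormedType.Exports.
Set Implicit Arguments.
Unset Strict Implicit.
Unset Printing Implicit Defensive.
Local Open Scope classical_set_scope.
Local Open Scope ring_scope.

Definition grid (n : nat) : set (int * int) :=
  [set p | (1 <= p.1 <= n%:Z) && (1 <= p.2 <= n%:Z)].

Definition is_line (R : realType) (l : set (R * R)) : Prop :=
  exists a b c : R, (a, b) != (0, 0) /\ l = [set p | a * p.1 + b * p.2 = c].

Definition lattice_points (R : realType) (l : set (R * R)) : set (int * int) :=
  [set p | l (p.1%:~R, p.2%:~R)].

(* [fset_set] sends an infinite set to the empty one; [card_pts] is only meant for
   finite sets. *)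
Definition card_pts (A : set (int * int)) : nat := #|` fset_set A |.

(* Sequences indexed by the positive integers are functions on [nat] whose
   value at 0 is never constrained and never used. *)
Definition positive_seq (R : realType) (k : nat -> R) : Prop :=
  forall n, (0 < n)%N -> 0 < k n.

Definition monotone_seq (R : realType) (k : nat -> R) : Prop :=
  forall m n, (0 < m)%N -> (m <= n)%N -> k m <= k n.

(* Main.v *)
Require Import Defs.
From mathcomp Require Import all_boot all_order all_algebra finmap.
From mathcomp Require Import all_classical all_reals all_analysis.
From mathcomp Require Import zify ring lra.
Import Order.TTheory GRing.Theory Num.Theory numFieldNormedType.Exports.
Local Open Scope classical_set_scope.
Local Open Scope ring_scope.

(** Write f(n) for the number of points of S in [1,n]^2. Covering the square by
    rows gives f(n) <= n k(n), so the hypothesis on the liminf says that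
    f(n) >= (1 - e) n k(n) for all large n: almost every row and column is as
    full as it may be. If k grows too slowly, this forces too many points to lie
    near the main diagonal, which few lines of slope 1 cover.

    Inclusion-exclusion makes this precise. For m <= n, the strips [1,m] x [1,n]
    and [1,n] x [1,m] have at most m k(n) points each and meet in f(m) points,
    so the square (m,n]^2 has at least f(n) + f(m) - 2 m k(n) points
    ([corner_square_ge]). Apply this to the L squares (jq, (j+1)q]^2, j < L,
    and add up; by [sum_block_weights], the sum of the lower bounds is, up to
    an error governed by e, equal to
      q (2 (k(q) + k(2q) + ... + k(Lq)) - L k(Lq)).
    The points of all these squares satisfy |x - y| < q, so they lie on fewer
    than 2q lines of slope 1 and there are at most 2q k(Lq) of them
    ([sum_diagonal_blocks_le]). With e = 1 / L^2 this gives
    ([sum_multiples_le])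
      2 (k(q) + ... + k(Lq)) <= (L + 4) k(Lq)   for all large q.

    As k is monotone, the partial sums K(n) = k(1) + ... + k(n) then satisfy
    K(n) <= b n k(n) for large n, where b = 1/2 + 3/L ([partial_sum_le]).
    This is the discrete form of K' / K >= 1 / (b n), so K(n) grows at least
    like n^a whenever a < 1/b, and hence k(n) >= K(n) / (b n) grows at least
    like n^(a - 1) ([powR_lower_bound_of_partial_sums]). Since 1/b tends to 2
    with L, every exponent c = a - 1 < 1 is reached. *)

(** * Counting points in boxes *)

(** The box is (a,b] x (c,d]: with half-open sides, adjacent boxes share an
    endpoint and the squares [1,n]^2 are the boxes from 0 to n. *)
Definition box (s : nat -> nat -> bool) (a b c d : nat) : nat :=
  (\sum_(a.+1 <= x < b.+1) \sum_(c.+1 <= y < d.+1) s x y)%N.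

Lemma box_catx (s : nat -> nat -> bool) a b c p q : (a <= b <= c)%N ->
  box s a c p q = (box s a b p q + box s b c p q)%N.
Proof.
by move=> /andP[ab bc]; rewrite /box (@big_cat_nat _ _ _ b.+1) //=.
Qed.

Lemma box_caty (s : nat -> nat -> bool) a b c p q : (a <= b <= c)%N ->
  box s p q a c = (box s p q a b + box s p q b c)%N.
Proof.
move=> /andP[ab bc]; rewrite /box -big_split /=; apply: eq_bigr => x _.
by rewrite (@big_cat_nat _ _ _ b.+1).
Qed.

Lemma box_tr (s : nat -> nat -> bool) a b c d :
  box s a b c d = box (fun x y => s y x) c d a b.
Proof. by rewrite /box exchange_big_nat. Qed.

Lemma box_le_width (R : numDomainType) (s : nat -> nat -> bool)
    (a b c d : nat) (K : R) : (a <= b)%N ->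
  (forall x, (a < x <= b)%N -> (\sum_(c.+1 <= y < d.+1) s x y)%N%:R <= K) ->
  (box s a b c d)%:R <= (b%:R - a%:R) * K.
Proof.
move=> ab hK; rewrite /box natr_sum.
have -> : (b%:R - a%:R) * K = \sum_(a.+1 <= x < b.+1) K.
  by rewrite sumr_const_nat subSS -natrB // mulr_natl.
by rewrite ler_sum_nat.
Qed.

(** Inclusion-exclusion: removing from the large square its first m columns and
    its first m rows, each of at most K points, removes the small square twice,
    so the count of the small square comes back with a plus sign. *)
Lemma corner_square_ge (R : realFieldType) (s : nat -> nat -> bool) (m n : nat)
    (K : R) : (m <= n)%N ->
  (forall x, (0 < x <= n)%N -> (\sum_(1 <= y < n.+1) s x y)%N%:R <= K) ->
  (forall y, (0 < y <= n)%N -> (\sum_(1 <= x < n.+1) s x y)%N%:R <= K) ->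
  (box s 0 n 0 n)%:R + (box s 0 m 0 m)%:R - 2 * m%:R * K
    <= (box s m n m n)%:R.
Proof.
move=> mn hcol hrow.
have left_le : (box s 0 m 0 n)%:R <= (m%:R - 0%:R) * K.
  apply: box_le_width => // x /andP[x0 xm]; apply: hcol.
  by rewrite x0 (leq_trans xm).
have bot_le : (box s 0 n 0 m)%:R <= (m%:R - 0%:R) * K.
  rewrite box_tr; apply: box_le_width => // x /andP[x0 xm]; apply: hrow.
  by rewrite x0 (leq_trans xm).
have e1 : box s 0 n 0 n = (box s 0 m 0 n + box s m n 0 n)%N.
  by apply: box_catx.
have e2 : box s m n 0 n = (box s m n 0 m + box s m n m n)%N.
  by apply: box_caty.
have e3 : box s 0 n 0 m = (box s 0 m 0 m + box s m n 0 m)%N.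
  by apply: box_catx.
rewrite e1 e2 !natrD; rewrite e3 natrD in bot_le.
rewrite mulr0n subr0 in left_le bot_le; lra.
Qed.

Lemma big_nat_blocks (V : Type) (idx : V) (op : Monoid.law idx) (F : nat -> V)
    (q L : nat) :
  \big[op/idx]_(j < L) \big[op/idx]_((j * q).+1 <= x < (j.+1 * q).+1) F x =
  \big[op/idx]_(1 <= x < (L * q).+1) F x.
Proof.
elim: L => [|L IH]; first by rewrite big_ord0 mul0n big_geq.
rewrite big_ord_recr /= IH -(@big_cat_nat _ _ _ (L * q).+1) //.
by rewrite ltnS leq_mul2r leqnSn orbT.
Qed.

(** A point (x,y) of a block of side q on the diagonal has |x - y| < q, hence
    lies on the line x + q = y + d for exactly one d in [0, 2q). *)
Lemma sum_diagonal_blocks_le (s : nat -> nat -> bool) (q L : nat) :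
  (\sum_(j < L) box s (j * q) (j.+1 * q) (j * q) (j.+1 * q) <=
   \sum_(d < 2 * q)
      box (fun x y => s x y && (x + q == y + d)) 0 (L * q) 0 (L * q))%N.
Proof.
rewrite [leqRHS]exchange_big -big_nat_blocks; apply: leq_sum => j _.
rewrite /box [leqLHS]big_nat_cond [leqRHS]big_nat_cond.
apply: leq_sum => x /andP[/andP[xl xr] _].
rewrite (big_nat_widenl _ 1) // (big_nat_widen _ _ (L * q).+1); last first.
  by rewrite ltnS leq_mul2r ltn_ord orbT.
rewrite exchange_big /= big_mkcond; apply: leq_sum => y _.
case: ifP => // /andP[yl yr]; rewrite /= in yl yr.
have dq : (x + q - y < 2 * q)%N by rewrite !ltnS mulSn in xr yr; lia.
rewrite (bigD1 (Ordinal dq)) //=.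
have -> : (x + q == y + (x + q - y))%N.
  by rewrite !ltnS mulSn in xr yr; apply/eqP; lia.
by rewrite andbT leq_addr.
Qed.

(** Passes from finite sets of integer points to double sums over natural
    numbers, where boxes are cut and recombined by big operator lemmas. *)
Lemma card_pts_box (A : set (int * int)) (n : nat) :
  card_pts (A `&` grid n) =
  box (fun x y => `[< A (x%:Z, y%:Z) >]) 0 n 0 n.
Proof.
pose f (p : nat * nat) := (p.1%:Z, p.2%:Z).
pose r := [seq (x, y) | x <- iota 1 n, y <- iota 1 n].
have finj : injective f by move=> [a b] [c d] [-> ->].
have memg p : grid n p -> exists2 u, u \in r & f u = p.
  case: p => a b /andP[/= /andP[a1 an] /andP[b1 bn]].
  exists (`|a|%N, `|b|%N).
    by apply: allpairs_f; rewrite mem_iota; lia.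
  by rewrite /f /=; congr pair; lia.
have rg u : u \in r -> grid n (f u).
  case/allpairsP => -[x y] [/= hx hy ->]; rewrite /grid /= /f /=.
  by move: hx hy; rewrite !mem_iota; lia.
have fin : finite_set (A `&` grid n).
  apply: (@sub_finite_set _ _ [set x | x \in [seq f u | u <- r]]).
    by move=> p [_ /memg[u ur <-]] /=; apply: map_f.
  exact: finite_seq.
have perm : perm_eq (fset_set (A `&` grid n))
    [seq f u | u <- r & `[< A (f u) >]].
  apply: uniq_perm; first exact: fset_uniq.
    rewrite map_inj_uniq // filter_uniq // allpairs_uniq ?iota_uniq //.
    by move=> [? ?] [? ?].
  move=> p; rewrite in_fset_set //; apply/idP/mapP.
    rewrite inE => -[Ap /memg[u ur uE]]; exists u => //.
    by rewrite mem_filter ur andbT; apply/asboolP; rewrite uE.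
  case=> u; rewrite mem_filter => /andP[/asboolP Au /rg gu] ->.
  by rewrite inE.
rewrite /card_pts (perm_size perm) size_map size_filter -sum1_count.
rewrite /r big_mkcond big_allpairs /box /index_iota subn1 /=.
by apply: eq_bigr => x _; apply: eq_bigr => y _; rewrite /f /=; case: asboolP.
Qed.

(** Presents a column as the part of the square lying on a line, the form in
    which the hypothesis on lines bounds it. *)
Lemma sum_column_le_box (s : nat -> nat -> bool) (n x : nat) : (0 < x <= n)%N ->
  (\sum_(1 <= y < n.+1) s x y <=
     box (fun x' y => s x' y && (x' == x)) 0 n 0 n)%N.
Proof.
move=> xn; rewrite /box [leqRHS](bigD1_seq x) ?iota_uniq ?mem_index_iota //=.
by apply: leq_trans (leq_addr _ _); apply: leq_sum => y _; rewrite eqxx andbT.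
Qed.

(** * Comparing the diagonal blocks with the lines of slope 1 *)

(** The lower bounds for the diagonal blocks, divided by q, when f(jq) is
    replaced by its maximal value jq a(j), with a(j) = k(jq). *)
Lemma sum_block_weights (R : comNzRingType) (a : nat -> R) (L : nat) :
  \sum_(j < L) (j.+1%:R * a j.+1 + j%:R * a j - 2 * j%:R * a j.+1) =
  2 * (\sum_(j < L) a j.+1) - L%:R * a L.
Proof.
elim: L => [|L IH]; first by rewrite !big_ord0; ring.
by rewrite !big_ord_recr /= IH -!natr1; ring.
Qed.

(** The average of k over the multiples of q up to Lq is at most about half of
    its last value k(Lq): the bounds of [corner_square_ge], summed over the
    diagonal blocks, cannot exceed that of [sum_diagonal_blocks_le]. The
    deficiency 1 / L^2 of the squares is small enough for the accumulated error
    over L blocks to be at most 2 q k(Lq), as large as the upper bound. *)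
Lemma sum_multiples_le (R : realType) (k : nat -> R) (s : nat -> nat -> bool)
    (L q : nat) (k_gt0 : positive_seq k) (k_mono : monotone_seq k) :
  (0 < q)%N -> (0 < L)%N ->
  (forall n x, (0 < x <= n)%N -> (\sum_(1 <= y < n.+1) s x y)%N%:R <= k n) ->
  (forall n y, (0 < y <= n)%N -> (\sum_(1 <= x < n.+1) s x y)%N%:R <= k n) ->
  (forall n d, (0 < n)%N ->
     (box (fun x y => s x y && (x + q == y + d)%N) 0 n 0 n)%:R <= k n) ->
  (forall n, (q <= n)%N ->
     (1 - L%:R^-2) * (n%:R * k n) <= (box s 0 n 0 n)%:R) ->
  2 * (\sum_(j < L) k (j.+1 * q)%N) <= (L%:R + 4) * k (L * q)%N.
Proof.
move=> q0 L0 hcol hrow hdiag hfull.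
pose a j := k (j * q)%N; pose f n : R := (box s 0 n 0 n)%:R.
have q0R : 0 < q%:R :> R by rewrite ltr0n.
have L0R : 0 < L%:R :> R by rewrite ltr0n.
have aL0 : 0 < a L by apply: k_gt0; rewrite muln_gt0 L0.
have upper : (\sum_(j < L) box s (j * q) (j.+1 * q) (j * q) (j.+1 * q))%N%:R
    <= (2 * q)%:R * a L.
  apply: (@le_trans _ _ (\sum_(d < 2 * q)
      box (fun x y => s x y && (x + q == y + d)) 0 (L * q) 0 (L * q))%N%:R).
    by rewrite ler_nat sum_diagonal_blocks_le.
  have -> : (2 * q)%:R * a L = \sum_(d < 2 * q) a L.
    by rewrite sumr_const card_ord mulr_natl.
  rewrite natr_sum.
  by apply: ler_sum => d _; apply: hdiag; rewrite muln_gt0 L0.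
(* For j = 0 both sides vanish, although k 0 is arbitrary. *)
have full j : (1 - L%:R^-2) * (j%:R * q%:R * a j) <= f (j * q)%N.
  have [->|j0] := posnP j; first by rewrite !mul0r mulr0 /f mul0n ler0n.
  by have := hfull (j * q)%N; rewrite natrM; apply; rewrite leq_pmull.
have square (j : 'I_L) :
    q%:R * (j.+1%:R * a j.+1 + j%:R * a j - 2 * j%:R * a j.+1)
      - q%:R * (2 * L%:R^-1 * a L) <=
    (box s (j * q) (j.+1 * q) (j * q) (j.+1 * q))%:R.
  have jq : (j * q <= j.+1 * q)%N by rewrite leq_mul2r leqnSn orbT.
  have := @corner_square_ge R s _ _ (a j.+1) jq
    (hcol (j.+1 * q)%N) (hrow (j.+1 * q)%N).
  apply: le_trans; have := full j; have := full j.+1; rewrite natrM -/(f _).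
  (* Each of the counts f((j+1)q) and f(jq) contributes one such error. *)
  have le_aL i : (i <= L)%N -> L%:R^-2 * (i%:R * q%:R * a i)
      <= q%:R * (L%:R^-1 * a L).
    move=> iL; have [->|i0] := posnP i.
      by rewrite !mul0r mulr0 !mulr_ge0 ?invr_ge0 // ltW.
    have -> : q%:R * (L%:R^-1 * a L) = L%:R^-2 * (L%:R * q%:R * a L).
      by field; rewrite gt_eqF.
    rewrite ler_wpM2l ?invr_ge0 ?exprn_ge0 // ler_pM ?mulr_ge0 //.
    - by rewrite ltW // k_gt0 // muln_gt0 i0.
    - by rewrite ler_wpM2r // ler_nat.
    - by apply: k_mono; rewrite ?muln_gt0 ?i0 // leq_mul2r iL orbT.
  by have := le_aL _ (ltn_ord j); have := le_aL _ (ltnW (ltn_ord j)); lra.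
have : \sum_(j < L)
    (q%:R * (j.+1%:R * a j.+1 + j%:R * a j - 2 * j%:R * a j.+1)
      - q%:R * (2 * L%:R^-1 * a L)) <= (2 * q)%:R * a L.
  by apply: le_trans upper; rewrite natr_sum; apply: ler_sum => j _.
have err : \sum_(j < L) q%:R * (2 * L%:R^-1 * a L) = q%:R * (2 * a L).
  by rewrite sumr_const card_ord -mulr_natl; field; rewrite gt_eqF.
rewrite sumrB err -mulr_sumr sum_block_weights.
rewrite natrM [2 * q%:R]mulrC -mulrBr -mulrA ler_pM2l // => main.
rewrite -/(a L); lra.
Qed.

(** * From averages to growth *)

(** On each block of length q the monotone function k is bounded by its value at
    the right end. The fewer than L terms left when n is not a multiple of L
    cost L k(n), at most n k(n) / L as n >= L^2; this explains the 3 in place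
    of 2. *)
Lemma partial_sum_le (R : realType) (k : nat -> R) (L N : nat)
    (k_gt0 : positive_seq k) (k_mono : monotone_seq k) :
  (0 < L)%N ->
  (forall q, (N <= q)%N ->
     2 * (\sum_(j < L) k (j.+1 * q)%N) <= (L%:R + 4) * k (L * q)%N) ->
  forall n, (L * (N + L) <= n)%N ->
    \sum_(1 <= j < n.+1) k j <= (2^-1 + 3 / L%:R) * (n%:R * k n).
Proof.
move=> L0 hmult n nN; pose q := (n %/ L)%N.
have Nq : (N + L <= q)%N by rewrite /q leq_divRL // mulnC.
have q0 : (0 < q)%N by lia.
have L0R : 0 < L%:R :> R by rewrite ltr0n.
have qn : (L * q <= n)%N by rewrite mulnC leq_trunc_div.
have Lq0 : (0 < L * q)%N by rewrite muln_gt0 L0.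
have n0 : (0 < n)%N by apply: leq_trans qn.
have kn0 := k_gt0 _ n0.
rewrite (@big_cat_nat _ _ _ (L * q).+1) //=.
have head : \sum_(1 <= j < (L * q).+1) k j <=
    q%:R * \sum_(j < L) k (j.+1 * q)%N.
  rewrite -big_nat_blocks mulr_sumr; apply: ler_sum => j _.
  have -> : q%:R * k (j.+1 * q)%N =
      \sum_((j * q).+1 <= x < (j.+1 * q).+1) k (j.+1 * q)%N.
    by rewrite sumr_const_nat subSS mulSn addnK mulr_natl.
  rewrite ler_sum_nat // => i /andP[il ir]; apply: k_mono => //.
  exact: leq_trans il.
have tail : \sum_((L * q).+1 <= j < n.+1) k j <= L%:R * k n.
  apply: (@le_trans _ _ (\sum_((L * q).+1 <= j < n.+1) k n)).
    rewrite ler_sum_nat // => i /andP[il ir]; apply: k_mono => //.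
    exact: leq_trans il.
  rewrite sumr_const_nat subSS -[leLHS]mulr_natl
    ler_wpM2r ?(ltW kn0) // ler_nat.
  by have := ltn_mod n L; rewrite L0 {1 2}(divn_eq n L) -/q; lia.
have mult : 2 * (\sum_(j < L) k (j.+1 * q)%N) <= (L%:R + 4) * k n.
  have qN : (N <= q)%N by lia.
  apply: le_trans (hmult _ qN) _; rewrite ler_wpM2l ?addr_ge0 //.
  exact: k_mono.
have qnR : L%:R * q%:R <= n%:R :> R by rewrite -natrM ler_nat.
have LnR : L%:R * L%:R <= n%:R :> R.
  rewrite -natrM ler_nat; apply: leq_trans nN.
  by rewrite leq_mul2l leq_addl orbT.
apply: le_trans (lerD head tail) _.
have -> : (2^-1 + 3 / L%:R) * (n%:R * k n) =
   2^-1 * ((L%:R + 4) * k n) * (n%:R / L%:R) + n%:R / L%:R * k n.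
  by field; rewrite gt_eqF.
apply: lerD; last by rewrite ler_wpM2r ?(ltW kn0) // ler_pdivlMr.
rewrite mulrC ler_pM //.
- by apply: sumr_ge0 => j _; rewrite ltW // k_gt0 // muln_gt0.
- by rewrite -ler_pdivrMl // invrK //; lra.
- by rewrite ler_pdivlMr // mulrC.
Qed.

(** The hypothesis is a discrete differential inequality for the partial sums K:
    as k(n+1) = K(n+1) - K(n), its instance at n+1 reads
    K(n) <= (1 - 1/(b(n+1))) K(n+1). With 1 - y <= exp(-y) and
    ln(n+1) - ln(n) <= 1/n, it makes K(n) / n^(c+1) nondecreasing once
    1/(b(n+1)) is at least (c+1)/n, which happens because (c+1) b < 1. *)
Lemma powR_lower_bound_of_partial_sums (R : realType) (k : nat -> R)
    (c b : R) (N : nat)    (k_gt0 : positive_seq k) :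
  0 < b -> (c + 1) * b < 1 ->
  (forall n, (N <= n)%N ->
     \sum_(1 <= j < n.+1) k j <= b * (n%:R * k n)) ->
  exists2 C, 0 < C & \forall n \near \oo, C * n%:R `^ c <= k n.
Proof.
move=> b0 cb hN; set K := fun n => \sum_(1 <= j < n.+1) k j.
pose w n := K n * expR (- ((c + 1) * ln n%:R)).
(* From M on, (c + 1) * b * (n + 1) <= n. *)
pose M := (maxn N (Num.truncn ((c + 1) * b / (1 - (c + 1) * b))).+1).
have M0 : (0 < M)%N by rewrite /M leq_max orbT.
have K0 n : (0 < n)%N -> 0 < K n.
  move=> n0; rewrite /K big_nat_recr //= ltr_wpDl ?k_gt0 //.
  by rewrite big_nat; apply: sumr_ge0 => i /andP[i0 _]; rewrite ltW // k_gt0.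
have step n : (M <= n)%N -> w n <= w n.+1.
  move=> Mn; have n0 : (0 < n)%N by apply: leq_trans Mn.
  have n0R : 0 < n%:R :> R by rewrite ltr0n.
  have n1R : 0 < n.+1%:R :> R by rewrite ltr0n.
  have y0 : 0 < b * n.+1%:R by rewrite mulr_gt0.
  have KS : K n <= K n.+1 * expR (- (b * n.+1%:R)^-1).
    have NS : (N <= n.+1)%N.
      by apply: leqW; apply: leq_trans Mn; rewrite leq_maxl.
    have := hN _ NS; rewrite -/(K n.+1).
    have KE : K n.+1 = K n + k n.+1 by rewrite /K big_nat_recr.
    rewrite mulrA -ler_pdivrMl // => kge.
    apply: (@le_trans _ _ (K n.+1 * (1 - (b * n.+1%:R)^-1))); last first.
      by rewrite ler_wpM2l ?expR_ge1Dx // ltW // K0.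
    move: kge; set y := _^-1 => kge; lra.
  have lnS : (c + 1) * (ln n.+1%:R - ln n%:R) <= (b * n.+1%:R)^-1.
    have [c1|c1] := leP (c + 1) 0.
      apply: (@le_trans _ _ 0); last by rewrite invr_ge0 ltW.
      rewrite mulr_le0_ge0 // subr_ge0 ler_ln ?posrE // ler_nat //.
    apply: (@le_trans _ _ ((c + 1) * n%:R^-1)).
      rewrite ler_wpM2l ?(ltW c1) // -ln_div ?posrE //.
      have -> : n.+1%:R / n%:R = 1 + n%:R^-1 :> R.
        by rewrite -natr1; field; rewrite gt_eqF.
      apply: le_ln1Dx.
      by rewrite (lt_trans _ (_ : 0 < n%:R^-1)) ?invr_gt0 // ltrN10.
    rewrite -[leRHS]div1r ler_pdivlMr // -mulrA.
    have : (c + 1) * b / (1 - (c + 1) * b) < n%:R.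
      apply: lt_le_trans (_ : M%:R <= _); last by rewrite ler_nat.
      apply: lt_le_trans (truncnS_gt _) _; rewrite ler_nat leq_maxr //.
    rewrite ltr_pdivrMr ?subr_gt0 // => hn.
    have -> : (c + 1) * (n%:R^-1 * (b * n.+1%:R)) =
        ((c + 1) * b * n.+1%:R) / n%:R.
      by field; rewrite gt_eqF.
    rewrite ler_pdivrMr // mul1r -natr1; lra.
  rewrite /w; apply: (@le_trans _ _
    (K n.+1 * expR (- (b * n.+1%:R)^-1) * expR (- ((c + 1) * ln n%:R)))).
    by rewrite ler_wpM2r // expR_ge0.
  rewrite -mulrA -expRD ler_wpM2l ?(ltW (K0 _ _)) // ler_expR.
  move: lnS; set y := _^-1 => lnS; lra.
have wM n : (M <= n)%N -> w M <= w n.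
  move=> /subnK <-; elim: (n - M)%N => [//|d IH].
  by apply: le_trans IH _; rewrite addSn; apply: step; rewrite leq_addl.
exists (w M / b); first by rewrite divr_gt0 // mulr_gt0 ?expR_gt0 ?K0.
exists M => // n /= Mn.
have n0 : (0 < n)%N by apply: leq_trans Mn.
have n0R : 0 < n%:R :> R by rewrite ltr0n.
have NM : (N <= n)%N by apply: leq_trans Mn; rewrite leq_maxl.
rewrite mulrAC ler_pdivrMr // -(ler_pM2r n0R).
apply: (@le_trans _ _ (K n)); last first.
  by have := hN _ NM; rewrite -/(K n); lra.
have -> : w M * n%:R `^ c * n%:R = w M * expR ((c + 1) * ln n%:R).
  rewrite /powR gt_eqF // mulrDl mul1r expRD lnK ?posrE // mulrA //.
rewrite -ler_pdivlMr ?expR_gt0 // -expRN; exact: wM.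
Qed.

(** * Applying the hypotheses on S *)

Lemma lt_limn_einf_near (R : realType) (u : nat -> \bar R) (a : \bar R) :
  (a < limn_einf u)%E -> \forall n \near \oo, (a < u n)%E.
Proof.
rewrite limn_einf_lim => a_lt.
have /(_ [set y | a < y]%E) : einfs u @ \oo --> limn (einfs u).
  exact: is_cvg_einfs.
case; first by apply: open_nbhs_nbhs; split; first exact: open_ereal_gt_ereal.
move=> N _ hN; exists N => // n /= Nn; apply: (lt_le_trans (hN _ Nn)).
by apply: ereal_inf_lbound; exists n => /=.
Qed.

Theorem theorem3p2 (R : realType) (k : nat -> R)
  (k_gt0 : positive_seq k) (k_mono : monotone_seq k)
  (S : set (int * int))
  (S_lines : forall (l : set (R * R)) (n : nat), is_line l -> (0 < n)%N ->
     (card_pts (S `&` lattice_points l `&` grid n))%:R <= k n)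
  (S_liminf :
     limn_einf (fun n : nat =>
       ((card_pts (S `&` grid n))%:R / (k n * n%:R))%:E) = 1%:E) :
  forall c : R, c < 1 -> k =Omega_\oo (fun n : nat => n%:R `^ c).
Proof.
move=> c c1; pose s x y := `[< S (x%:Z, y%:Z) >].
(* Only lines of the directions (0,1), (1,0) and (1,1) are used. *)
have line_le (a b d : R) (e : nat -> nat -> bool) n : (0 < n)%N ->
    (a, b) != (0, 0) ->
    (forall x y, e x y -> a * x%:R + b * y%:R = d) ->
    (box (fun x y => s x y && e x y) 0 n 0 n)%:R <= k n.
  move=> n0 ab he; pose l : set (R * R) := [set p | a * p.1 + b * p.2 = d].
  apply: le_trans (S_lines l n _ n0); last by exists a, b, d.
  rewrite card_pts_box ler_nat /box; apply: leq_sum => x _.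
  apply: leq_sum => y _; case: andP => // -[/asboolP Sxy /he exy].
  by case: asboolP => // -[]; split.
have col_le n x : (0 < x <= n)%N -> (\sum_(1 <= y < n.+1) s x y)%N%:R <= k n.
  move=> xn; have n0 : (0 < n)%N by lia.
  apply: le_trans (line_le 1 0 x%:R (fun x' _ => x' == x) n n0 _ _).
  - by rewrite ler_nat sum_column_le_box.
  - by rewrite xpair_eqE oner_eq0.
  - by move=> x' y /eqP ->; ring.
have row_le n y : (0 < y <= n)%N -> (\sum_(1 <= x < n.+1) s x y)%N%:R <= k n.
  move=> yn; have n0 : (0 < n)%N by lia.
  apply: le_trans (line_le 0 1 y%:R (fun _ y' => y' == y) n n0 _ _).
  - by rewrite ler_nat box_tr (sum_column_le_box (fun y x => s x y)).
  - by rewrite xpair_eqE oner_eq0 andbF.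
  - by move=> x y' /eqP ->; ring.
have diag_le q n d : (0 < n)%N ->
    (box (fun x y => s x y && (x + q == y + d)%N) 0 n 0 n)%:R <= k n.
  move=> n0.
  apply: (line_le 1 (- 1) (d%:R - q%:R) (fun x y => (x + q == y + d)%N)) => //.
    by rewrite xpair_eqE oner_eq0.
  by move=> x y /eqP/(congr1 (fun n => n%:R : R)); rewrite !natrD; lra.
(* Chosen so that 3 / L < (1 - c) / 4. Then b = 1/2 + 3/L satisfies
   (c + 1) b < 1 because (1 + c) (3 - c) / 4 = 1 - (1 - c)^2 / 4. *)
pose L := (Num.truncn (12 / (1 - c))).+1.
have LR : 12 / (1 - c) < L%:R by exact: truncnS_gt.
have L0R : 0 < L%:R :> R by rewrite ltr0n.
have [N _ hN] : \forall n \near \oo,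
    ((1 - L%:R^-2)%:E < ((card_pts (S `&` grid n))%:R / (k n * n%:R))%:E)%E.
  apply: lt_limn_einf_near.
  by rewrite S_liminf lte_fin ltrBlDr ltrDl invr_gt0 exprn_gt0.
have mult_le q : (maxn N 1 <= q)%N ->
    2 * (\sum_(j < L) k (j.+1 * q)%N) <= (L%:R + 4) * k (L * q)%N.
  rewrite geq_max => /andP[Nq q0].
  apply: (@sum_multiples_le R k s L q) => // n; first exact: diag_le.
  move=> qn; have := ltW (hN n (leq_trans Nq qn)); rewrite lee_fin.
  have n0 : (0 < n)%N by apply: leq_trans qn.
  rewrite card_pts_box ler_pdivlMr ?[k n * _]mulrC //.
  by rewrite mulr_gt0 ?ltr0n // k_gt0.
rewrite eqOmegaE qualifE /=; apply/asboolP.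
have L3 : 3 / L%:R < (1 - c) / 4.
  rewrite ltr_pdivrMr //; rewrite ltr_pdivrMr ?subr_gt0 // in LR; lra.
have b0 : 0 < 2^-1 + 3 / L%:R :> R by rewrite addr_gt0 ?divr_gt0.
have cb : (c + 1) * (2^-1 + 3 / L%:R) < 1.
  have [c0|c0] := leP (c + 1) 0; last first.
    apply: (@lt_trans _ _ ((c + 1) * (2^-1 + (1 - c) / 4))).
      by rewrite ltr_pM2l // ltrD2l.
    have : 0 < (1 - c) ^+ 2 by rewrite exprn_gt0 // subr_gt0.
    by rewrite expr2; lra.
  by rewrite (le_lt_trans _ ltr01) // mulr_le0_ge0 // ltW.
have [C C0 hC] := @powR_lower_bound_of_partial_sums R k c _ _ k_gt0 b0 cb
  (@partial_sum_le R k L _ k_gt0 k_mono (ltn0Sn _) mult_le).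
exists C => //; near=> n.
rewrite ger0_norm ?powR_ge0 //; apply: (le_trans _ (ler_norm _)).
by near: n.
Unshelve. all: by end_near.
Qed.
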